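(* Let $L$ be the Lusztig automorphism of the $q$-Onsager algebra $\mathcal O_q$, with generators $A,B$. Then $$L = I + \sum_{n=1}^\infty \Biggl(\frac{\mathrm{ad}\,A}{q-q^{-1}}\prod_{r=1}^{n-1}\frac{(q^{2r}-q^{-2r})^2 I+(\mathrm{ad}_r A)(\mathrm{ad}_{-r}A)}{(q^{2r}-q^{-2r})(q^{2r+1}-q^{-2r-1})}\Biggr)\frac{\mathrm{ad}_n A}{q^{2n}-q^{-2n}},$$ $$L^{-1} = I + \sum_{n=1}^\infty \Biggl(\frac{\mathrm{ad}\,A}{q-q^{-1}}\prod_{r=1}^{n-1}\frac{(q^{2r}-q^{-2r})^2 I+(\mathrm{ad}_r A)(\mathrm{ad}_{-r}A)}{(q^{2r}-q^{-2r})(q^{2r+1}-q^{-2r-1})}\Biggr)\frac{\mathrm{ad}_{-n} A}{q^{2n}-q^{-2n}}.$$ Moreover, for all $X\in\mathcal O_q$, the map $$\frac{\mathrm{ad}\,A}{q-q^{-1}}\prod_{r=1}^{n-1}\frac{(q^{2r}-q^{-2r})^2 I+(\mathrm{ad}_r A)(\mathrm{ad}_{-r}A)}{(q^{2r}-q^{-2r})(q^{2r+1}-q^{-2r-1})}$$ vanishes at $X$ for all but finitely many $n\geq 1$.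
   Context: Let $\mathbb F$ be a field and fix $0\neq q\in\mathbb F$ that is not a root of unity. Algebras are associative with $1$. Write $[n]_q=(q^n-q^{-n})/(q-q^{-1})$. The $q$-Onsager algebra $\mathcal O_q$ is the $\mathbb F$-algebra with generators $A,B$ and relations $$A^3B-[3]_qA^2BA+[3]_qABA^2-BA^3=(q^2-q^{-2})^2(BA-AB),$$ $$B^3A-[3]_qB^2AB+[3]_qBAB^2-AB^3=(q^2-q^{-2})^2(AB-BA).$$ The Lusztig automorphism $L$ is the $\mathbb F$-algebra automorphism of $\mathcal O_q$ (found by Baseilhac and Kolb) that satisfies $$L(A)=A,\qquad L(B)=B+\frac{qA^2B-(q+q^{-1})ABA+q^{-1}BA^2}{(q-q^{-1})(q^2-q^{-2})},$$ $$L^{-1}(A)=A,\qquad L^{-1}(B)=B+\frac{q^{-1}A^2B-(q+q^{-1})ABA+qBA^2}{(q-q^{-1})(q^2-q^{-2})}.$$ For $r\in\mathbb Z$, $\mathrm{ad}_rA:\mathcal O_q\to\mathcal O_q$ is the $\mathbb F$-linear map $X\mapsto q^rAX-q^{-r}XA$, and $\mathrm{ad}\,A=\mathrm{ad}_0A$, i.e. $X\mapsto AX-XA$. The maps $\mathrm{ad}_rA$ ($r\in\mathbb Z$) mutually commute. Products of maps are compositions, $I$ is the identity map, and an empty product is $I$. The infinite sums are formal sums of linear maps, evaluated at each $X$ (where all but finitely many terms vanish). *)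

(* Defs.v *)
From HB Require Import structures.
From mathcomp Require Import all_boot all_order all_algebra.
From mathcomp Require Import finmap.
From mathcomp.multinomials Require Import monalg.
From mathcomp.classical Require boolp.

Set Implicit Arguments.
Unset Strict Implicit.
Unset Printing Implicit Defensive.

Import GRing.Theory.
Local Open Scope ring_scope.
Local Open Scope quotient_scope.

Definition not_root_of_unity (F : fieldType) (q : F) : Prop :=
  forall n : nat, (0 < n)%N -> q ^+ n != 1.

Definition qdiff (F : fieldType) (q : F) (k : nat) : F := q ^+ k - q ^- k.

(* The q-integer [n]_q *)
Definition qint (F : fieldType) (q : F) (n : nat) : F := qdiff q n / qdiff q 1.

(* Left side minus right side of the q-Dolan/Grady relation; exchanging x and
   y gives the second relation. *)
Definition qDolanGrady (F : fieldType) (q : F) (C : lalgType F) (x y : C) : C :=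
  (x ^+ 3 * y - qint q 3 *: (x ^+ 2 * y * x) + qint q 3 *: (x * y * x ^+ 2)
   - y * x ^+ 3)
  - qdiff q 2 ^+ 2 *: (y * x - x * y).

Lemma lrmorph_qDolanGrady (F : fieldType) (q : F) (C D : lalgType F)
    (f : {lrmorphism C -> D}) (x y : C) :
  f (qDolanGrady q x y) = qDolanGrady q (f x) (f y).
Proof.
by rewrite /qDolanGrady !(linearB, linearD, linearZ_LR, rmorphM, rmorphXn).
Qed.

Inductive ideal_gen (R : nzRingType) (S : R -> Prop) : R -> Prop :=
| ideal_gen_in x : S x -> ideal_gen S x
| ideal_gen0 : ideal_gen S 0
| ideal_genD x y : ideal_gen S x -> ideal_gen S y -> ideal_gen S (x + y)
| ideal_genM a x b : ideal_gen S x -> ideal_gen S (a * x * b).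

(* Noncommutative polynomials in two variables: the monoid algebra of the free
   monoid on bool. *)
Notation freeAlg2 F := {malg F[{fmonom bool}]}.

Section QOnsager.
Variables (F : fieldType) (q : F).

Definition freeA : freeAlg2 F := << fmu true >>.
Definition freeB : freeAlg2 F := << fmu false >>.

Definition qOnsager_relator (x : freeAlg2 F) : Prop :=
  x = qDolanGrady q freeA freeB \/ x = qDolanGrady q freeB freeA.

Definition qOnsager_ideal : pred (freeAlg2 F) :=
  fun x => boolp.asbool (ideal_gen qOnsager_relator x).

Lemma qOnsager_idealP x :
  reflect (ideal_gen qOnsager_relator x) (x \in qOnsager_ideal).
Proof. exact: boolp.asboolP. Qed.

Lemma qOnsager_ideal_zmod_closed : zmod_closed qOnsager_ideal.
Proof.
split=> [|x y /qOnsager_idealP hx /qOnsager_idealP hy].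
  exact/qOnsager_idealP/ideal_gen0.
apply/qOnsager_idealP/ideal_genD => //.
by have := ideal_genM (-1) 1 hy; rewrite mulN1r mulr1.
Qed.

HB.instance Definition _ :=
  GRing.isZmodClosed.Build (freeAlg2 F) qOnsager_ideal
    qOnsager_ideal_zmod_closed.

Lemma qOnsager_idealMl a x : x \in qOnsager_ideal -> a * x \in qOnsager_ideal.
Proof.
move=> /qOnsager_idealP hx; apply/qOnsager_idealP.
by have := ideal_genM a 1 hx; rewrite mulr1.
Qed.

Lemma qOnsager_idealMr a x : x \in qOnsager_ideal -> x * a \in qOnsager_ideal.
Proof.
move=> /qOnsager_idealP hx; apply/qOnsager_idealP.
by have := ideal_genM 1 a hx; rewrite mul1r.
Qed.

Lemma qOnsager_idealZ c x : x \in qOnsager_ideal -> c *: x \in qOnsager_ideal.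
Proof. by move=> hx; rewrite -mulr_algl qOnsager_idealMl. Qed.

Local Notation const_coeff :=
  (@mcoeff {fmonom bool} F (@one {fmonom bool})).

Lemma mcoeff1_freeA : const_coeff freeA = 0.
Proof. by rewrite /freeA mcoeffU fmP fm1 fmU. Qed.

Lemma mcoeff1_freeB : const_coeff freeB = 0.
Proof. by rewrite /freeB mcoeffU fmP fm1 fmU. Qed.

Lemma mcoeff1M (a b : freeAlg2 F) :
  const_coeff (a * b) = const_coeff a * const_coeff b.
Proof. exact: (rmorphM const_coeff). Qed.

Lemma mcoeff1_qDolanGrady (x y : freeAlg2 F) :
  const_coeff x = 0 -> const_coeff y = 0 -> const_coeff (qDolanGrady q x y) = 0.
Proof.
move=> x0 y0;
have eD a b : const_coeff a = 0 -> const_coeff b = 0 -> const_coeff (a + b) = 0.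
  by move=> a0 b0; rewrite mcoeffD a0 b0 addr0.
have eB a b : const_coeff a = 0 -> const_coeff b = 0 -> const_coeff (a - b) = 0.
  by move=> a0 b0; rewrite mcoeffB a0 b0 subr0.
have eZ c a : const_coeff a = 0 -> const_coeff (c *: a) = 0.
  by move=> a0; rewrite mcoeffZ a0 mulr0.
have eMr a b : const_coeff b = 0 -> const_coeff (a * b) = 0.
  by move=> b0; rewrite mcoeff1M b0 mulr0.
have eMl a b : const_coeff a = 0 -> const_coeff (a * b) = 0.
  by move=> a0; rewrite mcoeff1M a0 mul0r.
apply: (eB); last by apply: (eZ); apply: (eB); apply: (eMr).
apply: (eB); last by apply: (eMr); apply: (eMl).
apply: (eD); last by apply: (eZ); apply: (eMr); apply: (eMl).
by apply: (eB); [apply: (eMr) | apply: (eZ); apply: (eMr)].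
Qed.

Lemma mcoeff1_ideal x : x \in qOnsager_ideal -> const_coeff x = 0.
Proof.
move=> /qOnsager_idealP; elim=> {x} [x [] ->|||a x b _ IH].
- exact: mcoeff1_qDolanGrady mcoeff1_freeA mcoeff1_freeB.
- exact: mcoeff1_qDolanGrady mcoeff1_freeB mcoeff1_freeA.
- exact: mcoeff0.
- by move=> x y _ IHx _ IHy; rewrite mcoeffD IHx IHy addr0.
- by rewrite 2!mcoeff1M IH mulr0 mul0r.
Qed.

Lemma freeAlg2_scaleAr c (x y : freeAlg2 F) : c *: (x * y) = x * (c *: y).
Proof.
apply/malgP=> k; rewrite mcoeffZ !(mcoeffMlw _ (fsubset_refl _) (msuppZ_le c y)).
rewrite mcoeffMl mulr_sumr; apply: eq_bigr => k1 _; rewrite mulr_sumr.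
by apply: eq_bigr => k2 _; rewrite mcoeffZ mulrnAr mulrCA.
Qed.

Definition qOnsager_zmodClosed : zmodClosed (freeAlg2 F) :=
  GRing.ZmodClosed.clone (freeAlg2 F) qOnsager_ideal _.

Local Notation quotI := (Quotient.quot qOnsager_zmodClosed).

Definition qOnsager : Type := quotI.

HB.instance Definition _ := Choice.on qOnsager.
HB.instance Definition _ := GRing.Zmodule.on qOnsager.

Definition qOnsager_pi (x : freeAlg2 F) : qOnsager :=
  \pi_quotI x.

Definition qOnsager_repr (x : qOnsager) : freeAlg2 F :=
  repr (x : quotI).

Lemma qOnsager_reprK : cancel qOnsager_repr qOnsager_pi.
Proof. by move=> x; rewrite /qOnsager_pi /qOnsager_repr reprK. Qed.

Lemma qOnsager_piP x y :
  reflect (qOnsager_pi x = qOnsager_pi y) (x - y \in qOnsager_ideal).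
Proof. by rewrite Quotient.idealrBE; apply: eqP. Qed.

Definition qOnsager_one : qOnsager := qOnsager_pi 1.
Definition qOnsager_mul (x y : qOnsager) : qOnsager :=
  qOnsager_pi (qOnsager_repr x * qOnsager_repr y).
Definition qOnsager_scale (c : F) (x : qOnsager) : qOnsager :=
  qOnsager_pi (c *: qOnsager_repr x).

Lemma qOnsager_piD x y : qOnsager_pi (x + y) = qOnsager_pi x + qOnsager_pi y.
Proof. exact: (raddfD (\pi_quotI)). Qed.

Lemma qOnsager_pi0 : qOnsager_pi 0 = 0.
Proof. exact: (raddf0 (\pi_quotI)). Qed.

Lemma qOnsager_pi_eq0 x : (qOnsager_pi x == 0) = (x \in qOnsager_ideal).
Proof. by rewrite -qOnsager_pi0 -[x in RHS]subr0; apply/eqP/qOnsager_piP. Qed.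

Lemma qOnsager_reprP x : qOnsager_repr (qOnsager_pi x) - x \in qOnsager_ideal.
Proof. by apply/qOnsager_piP; rewrite qOnsager_reprK. Qed.

Lemma qOnsager_piM x y :
  qOnsager_pi (x * y) = qOnsager_mul (qOnsager_pi x) (qOnsager_pi y).
Proof.
apply/esym/qOnsager_piP; set x' := qOnsager_repr _; set y' := qOnsager_repr _.
rewrite -[x' * y'](subrK (x * y')) -addrA -mulrBl -mulrBr rpredD //.
  by rewrite qOnsager_idealMr ?qOnsager_reprP.
by rewrite qOnsager_idealMl ?qOnsager_reprP.
Qed.

Lemma qOnsager_piZ c x :
  qOnsager_pi (c *: x) = qOnsager_scale c (qOnsager_pi x).
Proof.
apply/esym/qOnsager_piP; rewrite -scalerBr.
by rewrite qOnsager_idealZ ?qOnsager_reprP.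
Qed.

Lemma qOnsager_mulA : associative qOnsager_mul.
Proof.
move=> x y z; rewrite -[x]qOnsager_reprK -[y]qOnsager_reprK.
by rewrite -[z]qOnsager_reprK -!qOnsager_piM mulrA.
Qed.

Lemma qOnsager_mul1 : left_id qOnsager_one qOnsager_mul.
Proof. by move=> x; rewrite -[x]qOnsager_reprK -qOnsager_piM mul1r. Qed.

Lemma qOnsager_mulr1 : right_id qOnsager_one qOnsager_mul.
Proof. by move=> x; rewrite -[x]qOnsager_reprK -qOnsager_piM mulr1. Qed.

Lemma qOnsager_mulDl : left_distributive qOnsager_mul +%R.
Proof.
move=> x y z; rewrite -[x]qOnsager_reprK -[y]qOnsager_reprK.
by rewrite -[z]qOnsager_reprK -qOnsager_piD -!qOnsager_piM -qOnsager_piD mulrDl.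
Qed.

Lemma qOnsager_mulDr : right_distributive qOnsager_mul +%R.
Proof.
move=> x y z; rewrite -[x]qOnsager_reprK -[y]qOnsager_reprK.
by rewrite -[z]qOnsager_reprK -qOnsager_piD -!qOnsager_piM -qOnsager_piD mulrDr.
Qed.

Lemma qOnsager_oner_neq0 : qOnsager_one != 0.
Proof.
rewrite qOnsager_pi_eq0; apply/negP => /mcoeff1_ideal/eqP.
by rewrite rmorph1 oner_eq0.
Qed.

HB.instance Definition _ := GRing.Zmodule_isNzRing.Build qOnsager
  qOnsager_mulA qOnsager_mul1 qOnsager_mulr1 qOnsager_mulDl qOnsager_mulDr
  qOnsager_oner_neq0.

Lemma qOnsager_scaleA a b x :
  qOnsager_scale a (qOnsager_scale b x) = qOnsager_scale (a * b) x.
Proof. by rewrite -[x]qOnsager_reprK -!qOnsager_piZ scalerA. Qed.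

Lemma qOnsager_scale1 : left_id 1 qOnsager_scale.
Proof. by move=> x; rewrite -[x]qOnsager_reprK -qOnsager_piZ scale1r. Qed.

Lemma qOnsager_scaleDr : right_distributive qOnsager_scale +%R.
Proof.
move=> c x y; rewrite -[x]qOnsager_reprK -[y]qOnsager_reprK.
by rewrite -qOnsager_piD -!qOnsager_piZ -qOnsager_piD scalerDr.
Qed.

Lemma qOnsager_scaleDl x : {morph qOnsager_scale^~ x : a b / a + b}.
Proof.
by move=> a b; rewrite -[x]qOnsager_reprK -!qOnsager_piZ -qOnsager_piD scalerDl.
Qed.

HB.instance Definition _ := GRing.Zmodule_isLmodule.Build F qOnsager
  qOnsager_scaleA qOnsager_scale1 qOnsager_scaleDr qOnsager_scaleDl.

Lemma qOnsager_scaleAl (c : F) (x y : qOnsager) : c *: (x * y) = c *: x * y.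
Proof.
rewrite -[x]qOnsager_reprK -[y]qOnsager_reprK.
by rewrite -[LHS]/(qOnsager_scale _ (qOnsager_mul _ _))
  -[RHS]/(qOnsager_mul (qOnsager_scale _ _) _)
  -qOnsager_piZ -!qOnsager_piM -qOnsager_piZ scalerAl.
Qed.

HB.instance Definition _ := GRing.Lmodule_isLalgebra.Build F qOnsager
  qOnsager_scaleAl.

Lemma qOnsager_scaleAr (c : F) (x y : qOnsager) : c *: (x * y) = x * (c *: y).
Proof.
rewrite -[x]qOnsager_reprK -[y]qOnsager_reprK.
by rewrite -[LHS]/(qOnsager_scale _ (qOnsager_mul _ _))
  -[RHS]/(qOnsager_mul _ (qOnsager_scale _ _))
  -qOnsager_piZ -!qOnsager_piM -qOnsager_piZ freeAlg2_scaleAr.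
Qed.

HB.instance Definition _ := GRing.Lalgebra_isAlgebra.Build F qOnsager
  qOnsager_scaleAr.

HB.instance Definition _ := GRing.isZmodMorphism.Build (freeAlg2 F) qOnsager
  qOnsager_pi (raddfB \pi_quotI).
HB.instance Definition _ := GRing.isScalable.Build F (freeAlg2 F) qOnsager _
  qOnsager_pi qOnsager_piZ.
HB.instance Definition _ := GRing.isMonoidMorphism.Build (freeAlg2 F) qOnsager
  qOnsager_pi (conj (erefl : qOnsager_pi 1 = 1) qOnsager_piM).

Definition genA : qOnsager := qOnsager_pi freeA.
Definition genB : qOnsager := qOnsager_pi freeB.

Lemma qOnsager_pi_qDolanGrady (x y : freeAlg2 F) :
  qOnsager_pi (qDolanGrady q x y)
  = qDolanGrady q (qOnsager_pi x) (qOnsager_pi y).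
Proof.
pose f : {lrmorphism freeAlg2 F -> qOnsager} := qOnsager_pi.
exact (lrmorph_qDolanGrady q f x y).
Qed.

Lemma qOnsager_rel1 : qDolanGrady q genA genB = 0.
Proof.
rewrite -qOnsager_pi_qDolanGrady; apply/eqP; rewrite qOnsager_pi_eq0.
by apply/qOnsager_idealP/ideal_gen_in; left.
Qed.

Lemma qOnsager_rel2 : qDolanGrady q genB genA = 0.
Proof.
rewrite -qOnsager_pi_qDolanGrady; apply/eqP; rewrite qOnsager_pi_eq0.
by apply/qOnsager_idealP/ideal_gen_in; right.
Qed.

Definition adA (r : int) (X : qOnsager) : qOnsager :=
  q ^ r *: (genA * X) - q ^ (- r) *: (X * genA).

Record Lusztig_automorphism (L : {lrmorphism qOnsager -> qOnsager})
    (Linv : qOnsager -> qOnsager) : Prop := {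
  LusztigK : cancel L Linv;
  LusztigVK : cancel Linv L;
  Lusztig_genA : L genA = genA;
  Lusztig_genB : L genB = genB + (qdiff q 1 * qdiff q 2)^-1 *:
    (q *: (genA ^+ 2 * genB) - (q + q^-1) *: (genA * genB * genA)
     + q^-1 *: (genB * genA ^+ 2));
  LusztigV_genA : Linv genA = genA;
  LusztigV_genB : Linv genB = genB + (qdiff q 1 * qdiff q 2)^-1 *:
    (q^-1 *: (genA ^+ 2 * genB) - (q + q^-1) *: (genA * genB * genA)
     + q *: (genB * genA ^+ 2))
}.

Definition adA_factor (r : nat) : qOnsager -> qOnsager :=
  (qdiff q (2 * r) * qdiff q (2 * r + 1))^-1 \*:
    ((qdiff q (2 * r) ^+ 2 \*: idfun) \+ (adA r%:Z \o adA (- r%:Z))).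

Definition adA_prod (n : nat) : qOnsager -> qOnsager :=
  ((qdiff q 1)^-1 \*: adA 0) \o
    \big[(@comp qOnsager qOnsager qOnsager)/idfun]_(1 <= r < n) adA_factor r.

End QOnsager.

Arguments adA {F} q r X.
Arguments adA_factor {F} q r X.
Arguments adA_prod {F} q n X.
Arguments genA {F q}.
Arguments genB {F q}.

(* S is the formal sum of the maps t 1, t 2, ...: at each X all but finitely
   many terms vanish, and S X is the sum of the remaining ones. *)
Definition is_formal_sum (V : nmodType) (t : nat -> V -> V) (S : V -> V) : Prop :=
  forall X : V, exists N : nat,
    (forall n : nat, (N < n)%N -> t n X = 0) /\
    S X = \sum_(1 <= n < N.+1) t n X.

(* Main.v *)
From HB Require Import structures.
Require Import Defs.
From mathcomp Require Import all_boot all_order all_algebra.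
From mathcomp Require Import ring.
From mathcomp.multinomials Require Import monalg.
From mathcomp.classical Require Import boolp functions.

Set Implicit Arguments.
Unset Strict Implicit.
Unset Printing Implicit Defensive.

Import GRing.Theory.
Local Open Scope ring_scope.

(** The maps in the theorem are polynomials in the two commuting operators
    l : X |-> A X and r : X |-> X A, so the theorem is about polynomials
    B_n(x, y) (band_poly) and T_n(x, y) (lusztig_poly): B_n(l, r) is the
    (n+1)-st product of the statement and T_n(l, r) is the identity plus the
    first n terms of the series.

    Write y = t + 1/t and y_i = t q^(2i) + 1/(t q^(2i)).  Then B_n(x, y) is a
    scalar multiple of the product of the x - y_i with |i| <= n.  Hence
    B_n(l, r) X = 0 says that X is banded with respect to A: it only connects
    eigenvalues of A that are at most n steps apart on the progression (y_i).
    The q-Dolan/Grady relation for A and B says exactly that B has width 1,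
    and widths add under multiplication, so every element is banded; this is
    the finiteness claim, and the series stops at each element.  Moreover T_n
    takes the value tau_i / tau_j at (y_i, y_j) when |i - j| <= n, where
    tau_i = t^(2i) q^(2 i^2): the series is conjugation by a function of A.
    It is therefore multiplicative; it fixes A and agrees with L on B, so it
    equals L.  Replacing q by 1/q inverts all the tau_i / tau_j and gives the
    inverse of L.

    The eigenvalues are only a heuristic.  What is proved is the following
    pair of congruences modulo B_1(y, z) for commuting x, y, z
    (band_poly_step, lusztig_poly_step):
      B_(n+1)(x, z) is a multiple of B_n(x, y);
      T_(n+1)(x, z) - T_n(x, y) T_1(y, z) is a multiple of B_n(x, y).
    Let x, y, z act on the map X |-> X B by multiplying by A on the left of X,
    between X and B, and on the right of B.  Then B_1(y, z) kills this map
    since B has width 1, and B_n(x, y) kills its value at any X of width n.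
    The congruences become: X B has width n+1, and the partial sums satisfy
    T(X B) = T(X) T(B).  Induction on words in A and B concludes. *)

(** * Band polynomials *)

Section BandPolynomials.
Variables (F : fieldType) (q : F) (R : comNzRingType) (c : {rmorphism F -> R}).
Implicit Types (x y z : R) (n k : nat).

Local Notation d k := (qdiff q k).

(** At y = t + 1/t the roots in x are q^k t + 1/(q^k t) and
    t / q^k + q^k / t.  For k = 2 n these are y_n and y_(-n), the two
    eigenvalues n steps away from y. *)
Definition strip k x y : R :=
  x ^+ 2 + y ^+ 2 - c (q ^+ k + q ^- k) * x * y + c (d k ^+ 2).

Definition band_ratio n x y : R :=
  c (d (2 * n) * d (2 * n + 1))^-1 * strip (2 * n) x y.

Fixpoint band_poly n x y : R :=
  if n is n'.+1 then band_poly n' x y * band_ratio n x y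
  else c (d 1)^-1 * (x - y).

Definition qcomm n x y : R :=
  c (d (2 * n))^-1 * (c (q ^+ n) * x - c (q ^- n) * y).

Fixpoint lusztig_poly n x y : R :=
  if n is n'.+1 then lusztig_poly n' x y + band_poly n' x y * qcomm n x y
  else 1.

(** The quotient of band_poly n x z by band_poly n.-1 x y, for n > 0 and z equal
    to y or to a neighbour of y.  In each of these three cases the quotient is,
    up to a scalar, the product of two linear factors in x; the formula
    interpolates the three products in z. *)
Definition band_step n x y z : R :=
  let a := c (d (2 * n) / d 1 * (d (2 * n + 1) / d 2)) in
  let b := c (d (2 * n) / d 1 * (d (2 * n - 1) / d 2)) in
  c (d (2 * n) * d (2 * n + 1))^-1 *
  (x ^+ 2 - x * (c (d (2 * n + 1) / d 1) * z - c (d (2 * n - 1) / d 1) * y)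
   + a * z ^+ 2 + b * y ^+ 2 + (1 - a - b) * y * z + c (d (2 * n) ^+ 2)).

(** The cofactor of band_poly 1 y z in band_step_ratio: its three coefficients
    are read off from the terms of degree at least 3 in z. *)
Definition band_cofactor n x y z : R :=
  let a := c (d (2 * n) / d 1 * (d (2 * n + 1) / d 2)) in
  let b := c (d (2 * n) / d 1 * (d (2 * n - 1) / d 2)) in
  c (d 1 * d 2 * d 3
     / (d (2 * n) * d (2 * n + 1) * (d (2 * n.+1) * d (2 * n.+1 + 1))))
  * ((c (d (2 * n + 1) / d 1) + c (q ^+ (2 * n.+1) + q ^- (2 * n.+1)) * a) * x
     - (1 - b + a * c (q ^+ 2 + q ^- 2)) * y - a * z).

(** The multiple of band_poly n x y that separates lusztig_poly n.+1 x z from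
    lusztig_poly n x y * lusztig_poly 1 y z.  By degree it is linear in x, y, z,
    and lusztig_step_ratio determines it recursively. *)
Definition lusztig_step n x y z : R :=
  c (d (2 * n.+1))^-1
  * (c (q ^+ n.+1) * (x + c (d (2 * n + 1) / d 1) * (y - z))
     - c (q ^- n.+1) * z).

Definition lusztig_cofactor n : R := c (d 3 / (q ^+ n.+1 * d (2 * n.+1))).

End BandPolynomials.

(** All these expressions commute with ring morphisms, which reduces identities
    over an integral domain to its field of fractions. *)
Section RingMorphism.
Variables (F : fieldType) (q : F) (R S : comNzRingType).
Variables (c : {rmorphism F -> R}) (f : {rmorphism R -> S}).
Implicit Types (n : nat) (x y z : R).

Let fE := (rmorphM f, rmorphB f, rmorphD f, rmorphXn f, rmorph1 f).

Lemma rmorph_band_ratio n x y :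
  f (band_ratio q c n x y) = band_ratio q (f \o c) n (f x) (f y).
Proof. by rewrite /band_ratio /strip !fE. Qed.

Lemma rmorph_band_poly n x y :
  f (band_poly q c n x y) = band_poly q (f \o c) n (f x) (f y).
Proof.
by elim: n => [|n IHn] /=; rewrite !fE ?IHn ?rmorph_band_ratio.
Qed.

Lemma rmorph_qcomm n x y : f (qcomm q c n x y) = qcomm q (f \o c) n (f x) (f y).
Proof. by rewrite /qcomm !fE. Qed.

Lemma rmorph_lusztig_poly n x y :
  f (lusztig_poly q c n x y) = lusztig_poly q (f \o c) n (f x) (f y).
Proof.
elim: n => [|n IHn]; first exact: rmorph1.
by rewrite [LHS]fE fE IHn rmorph_band_poly rmorph_qcomm.
Qed.

Lemma rmorph_band_step n x y z :
  f (band_step q c n x y z) = band_step q (f \o c) n (f x) (f y) (f z).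
Proof. by rewrite /band_step !fE. Qed.

Lemma rmorph_band_cofactor n x y z :
  f (band_cofactor q c n x y z) = band_cofactor q (f \o c) n (f x) (f y) (f z).
Proof. by rewrite /band_cofactor !fE. Qed.

Lemma rmorph_lusztig_step n x y z :
  f (lusztig_step q c n x y z) = lusztig_step q (f \o c) n (f x) (f y) (f z).
Proof. by rewrite /lusztig_step !fE. Qed.

Lemma rmorph_lusztig_cofactor n :
  f (lusztig_cofactor q c n) = lusztig_cofactor q (f \o c) n.
Proof. by []. Qed.
End RingMorphism.

(** * The one-step identities *)

Section Field.
Variables (F : fieldType) (q : F) (E : fieldType) (c : {rmorphism F -> E}).
Hypothesis d_neq0 : forall k, (0 < k)%N -> qdiff q k != 0.
Hypothesis q0 : q != 0.

Let cdE k : c (qdiff q k) = c q ^+ k - c q ^- k.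
Proof. by rewrite rmorphB fmorphV rmorphXn. Qed.

Let expS n : (2 * n.+1)%N = (2 * n + 2)%N.
Proof. by rewrite !mulnSr -!addnA. Qed.

Let expA n : ((2 * n + 2 + 2)%N = (2 * n + 4)%N) *
  ((2 * n + 4 + 2)%N = (2 * n + 6)%N) * ((2 * n + 2 - 1)%N = (2 * n + 1)%N) *
  ((2 * n + 2 + 1)%N = (2 * n + 3)%N) * ((2 * n + 4 - 1)%N = (2 * n + 3)%N) *
  ((2 * n + 4 + 1)%N = (2 * n + 5)%N).
Proof. by rewrite !(addnC (2 * n)%N) !(addnC _ 1%N) !(addnC _ 2%N). Qed.

Let expD n k : c q ^+ (2 * n + k) = c q ^+ n ^+ 2 * c q ^+ k.
Proof. by rewrite exprD mulnC exprM. Qed.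

(* The next three facts put the hypothesis that q is not a root of unity in the
   shapes in which cleared denominators occur. *)
Let units n j : (0 < j)%N ->
  c q ^+ n ^+ 2 * c q ^+ j * (c q ^+ n ^+ 2 * c q ^+ j) - 1 != 0.
Proof.
move=> j0; have := d_neq0 (ltn_addl (2 * n) j0).
rewrite -(fmorph_eq0 c) cdE; apply: contra; rewrite !subr_eq0 expD.
set a := c q ^+ n ^+ 2 * _ => /eqP a2; have a0 : a != 0.
  by apply: contra_eq_neq a2 => ->; rewrite mulr0 eq_sym oner_neq0.
by apply/eqP/(mulfI a0); rewrite a2 mulfV.
Qed.

Let units1 j : (0 < j)%N -> (c q * c q) ^+ j - 1 != 0.
Proof. by move=> j0; have := @units 0 j j0; rewrite expr1n mul1r exprMn. Qed.

Let units2 n : (c q ^+ n * c q * (c q ^+ n * c q)) ^+ 2 - 1 != 0.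
Proof. by have := @units n 2 isT; congr (_ - 1 != 0); ring. Qed.

(* Turns the scalars of the goal into rational functions of the two free field
   elements s, the image of q, and t, the image of q ^+ n. *)
Ltac scalars n E1 s t s0 t0 u u1 u12 ut2 :=
  have := @units2 n; have := @units1 1%N isT; rewrite expr1;
  have := @units1; have := @units n;
  have := expf_neq0 n q0; have := q0;
  rewrite -!(fmorph_eq0 c) rmorphXn;
  rewrite !(cdE, fmorph_div, fmorphV, rmorphD, rmorphM, rmorphXn) /=;
  have := @expD n;
  move: (c q) (c q ^+ n) => s t E1 s0 t0 u u1 u12 ut2;
  rewrite !{}E1 //.

(** With y and z neighbours on the progression, both sides of this identity are
    the same product of four linear factors in x, so that they agree modulo
    band_poly 1 y z. *)
Lemma band_step_ratio_field n x y z :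
  band_step q c n.+1 x y z * band_ratio q c n.+2 x z =
  band_ratio q c n.+1 x y * band_step q c n.+2 x y z
   + band_cofactor q c n.+1 x y z * band_poly q c 1 y z.
Proof.
rewrite /band_cofactor /band_poly /band_step /band_ratio /strip.
rewrite !expS !expA !(muln0, add0n).
scalars n E1 s t s0 t0 u u1 u12 ut2.
by field; rewrite s0 t0 u12 ut2 ?u ?u1.
Qed.

Lemma band_poly1_step_field x y z :
  band_poly q c 1 x z =
  band_poly q c 0 x y * band_step q c 1 x y z + band_poly q c 1 y z.
Proof.
rewrite /band_poly /band_step /band_ratio /strip !(muln1, expA).
have := @units1 1%N isT; have := @units1; have := q0.
rewrite expr1 -!(fmorph_eq0 c).
rewrite !(cdE, fmorph_div, fmorphV, rmorphD, rmorphM, rmorphXn) /=.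
move: (c q) => s s0 u1 u12.
by field; rewrite s0 u12 ?u1.
Qed.

Lemma lusztig_step_ratio_field n x y z :
  lusztig_step q c n x y z + band_step q c n.+1 x y z * qcomm q c n.+2 x z
  - qcomm q c n.+1 x y * lusztig_poly q c 1 y z
  = band_ratio q c n.+1 x y * lusztig_step q c n.+1 x y z
  + lusztig_cofactor q c n.+1 * band_poly q c 1 y z.
Proof.
rewrite /lusztig_step /lusztig_cofactor /lusztig_poly /qcomm.
rewrite /band_poly /band_step /band_ratio /strip.
rewrite !expS !expA !(muln0, add0n, exprS _ n, exprS _ n.+1).
scalars n E1 s t s0 t0 u u1 u12 ut2.
by field; rewrite ?u12 ?ut2 ?u ?u1 ?s0 ?t0.
Qed.

Lemma lusztig1_step_field x y z :
  lusztig_poly q c 1 x z =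
  lusztig_poly q c 1 y z + band_poly q c 0 x y * lusztig_step q c 0 x y z.
Proof.
rewrite /lusztig_step /lusztig_poly /qcomm /band_poly !muln1.
have := @units1 1%N isT; have := @units1; have := q0.
rewrite expr1 -!(fmorph_eq0 c).
rewrite !(cdE, fmorph_div, fmorphV, rmorphD, rmorphM, rmorphXn) /=.
move: (c q) => s s0 u1 u12.
by field; rewrite s0 u12 ?u1.
Qed.
End Field.

Section Domain.
Variables (F : fieldType) (q : F) (R : idomainType) (c : {rmorphism F -> R}).
Hypothesis d_neq0 : forall k, (0 < k)%N -> qdiff q k != 0.
Hypothesis q0 : q != 0.
Implicit Types (x y z : R) (n k : nat).

Let f : {rmorphism R -> {fraction R}} := @tofrac R.

Let frac_inj : injective f.
Proof. by move=> x y /eqP; rewrite [_ == _]tofrac_eq => /eqP. Qed.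

Let fE := (rmorph_band_poly q c f, rmorph_band_step q c f,
  rmorph_band_ratio q c f, rmorph_band_cofactor q c f,
  rmorph_lusztig_poly q c f, rmorph_lusztig_step q c f,
  rmorph_lusztig_cofactor q c f, rmorph_qcomm q c f).

Lemma band_step_ratio n x y z :
  band_step q c n.+1 x y z * band_ratio q c n.+2 x z =
  band_ratio q c n.+1 x y * band_step q c n.+2 x y z
   + band_cofactor q c n.+1 x y z * band_poly q c 1 y z.
Proof.
have := band_step_ratio_field (f \o c) d_neq0 q0 n (f x) (f y) (f z).
by rewrite -!fE -?(rmorphM f, rmorphB f, rmorphD f) => /frac_inj.
Qed.

Lemma band_poly1_step x y z :
  band_poly q c 1 x z =
  band_poly q c 0 x y * band_step q c 1 x y z + band_poly q c 1 y z.
Proof.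
have := band_poly1_step_field (f \o c) d_neq0 q0 (f x) (f y) (f z).
by rewrite -!fE -?(rmorphM f, rmorphB f, rmorphD f) => /frac_inj.
Qed.

Lemma lusztig_step_ratio n x y z :
  lusztig_step q c n x y z + band_step q c n.+1 x y z * qcomm q c n.+2 x z
  - qcomm q c n.+1 x y * lusztig_poly q c 1 y z
  = band_ratio q c n.+1 x y * lusztig_step q c n.+1 x y z
  + lusztig_cofactor q c n.+1 * band_poly q c 1 y z.
Proof.
have := lusztig_step_ratio_field (f \o c) d_neq0 q0 n (f x) (f y) (f z).
by rewrite -!fE -?(rmorphM f, rmorphB f, rmorphD f) => /frac_inj.
Qed.

Lemma lusztig1_step x y z :
  lusztig_poly q c 1 x z =
  lusztig_poly q c 1 y z + band_poly q c 0 x y * lusztig_step q c 0 x y z.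
Proof.
have := lusztig1_step_field (f \o c) d_neq0 q0 (f x) (f y) (f z).
by rewrite -!fE -?(rmorphM f, rmorphB f, rmorphD f) => /frac_inj.
Qed.

(** Widths add when one factor has width 1: whatever is at most n steps from y
    is at most n.+1 steps from a neighbour z of y. *)
Lemma band_poly_step n x y z : exists v,
  band_poly q c n.+1 x z =
  band_poly q c n x y * band_step q c n.+1 x y z + v * band_poly q c 1 y z.
Proof.
elim: n => [|n [v IHn]].
  by exists 1; rewrite mul1r; exact: band_poly1_step.
exists (v * band_ratio q c n.+2 x z
        + band_poly q c n x y * band_cofactor q c n.+1 x y z).
transitivity (band_poly q c n.+1 x z * band_ratio q c n.+2 x z) => //.
rewrite IHn mulrDl -mulrA band_step_ratio [band_poly q c n.+1 x y]/=.
by move: (band_poly q c 1 y z) => b1; ring.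
Qed.

(** The cocycle identity tau_i / tau_k = (tau_i / tau_j) (tau_j / tau_k) for the
    values of the Lusztig polynomials, as a congruence. *)
Lemma lusztig_poly_step n x y z : exists w,
  lusztig_poly q c n.+1 x z = lusztig_poly q c n x y * lusztig_poly q c 1 y z
    + band_poly q c n x y * lusztig_step q c n x y z + w * band_poly q c 1 y z.
Proof.
elim: n => [|n [w IHn]].
  by exists 0; rewrite mul0r addr0 mul1r; exact: lusztig1_step.
have [v vE] := band_poly_step n x y z.
exists (w + v * qcomm q c n.+2 x z
        + band_poly q c n x y * lusztig_cofactor q c n.+1).
transitivity
  (lusztig_poly q c n.+1 x z
   + band_poly q c n.+1 x z * qcomm q c n.+2 x z) => //.
have := lusztig_step_ratio n x y z.
rewrite IHn vE [band_poly q c n.+1 x y]/= [lusztig_poly q c n.+1 x y]/=.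
move: (band_poly q c 1 y z) (lusztig_poly q c 1 y z) => b1 t1.
move/(congr1 (fun r => band_poly q c n x y * r)) => E.
apply/eqP; rewrite -subr_eq0; move/eqP: E; rewrite -subr_eq0; congr (_ == _).
by ring.
Qed.
End Domain.

(** * Modules over polynomial rings *)

Section PolyModule.
Variables (R : comNzRingType) (V : lmodType R) (f : {linear V -> V}).

(** The linear map is a phantom argument: it selects the polynomial action, in
    which the variable acts as that map, on an unchanged carrier.  Iterating
    the construction makes a ring of polynomials in several variables act
    through commuting maps. *)
Definition poly_module of {linear V -> V} : Type := V.
Local Notation W := (poly_module f).
HB.instance Definition _ := GRing.Zmodule.on W.

Definition poly_scale (p : {poly R}) (v : W) : W :=
  \sum_(i < size p) p`_i *: iter i f v.

Lemma poly_scale_wide n (p : {poly R}) v : (size p <= n)%N ->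
  poly_scale p v = \sum_(i < n) p`_i *: iter i f (v : V).
Proof.
move=> le_pn; rewrite /poly_scale.
rewrite (big_ord_widen _ (fun i => p`_i *: iter i f v) le_pn) big_mkcond;
  apply: eq_bigr => i _; case: ltnP => // /(nth_default 0) ->.
by rewrite scale0r.
Qed.

Lemma poly_scaleDl v : {morph poly_scale^~ v : p r / p + r}.
Proof.
move=> p r; rewrite (poly_scale_wide _ (size_polyD p r)).
rewrite (poly_scale_wide _ (leq_maxl (size p) (size r))).
rewrite (poly_scale_wide _ (leq_maxr (size p) (size r))) -big_split;
  apply: eq_bigr => i _.
by rewrite coefD scalerDl.
Qed.

Lemma poly_scaleDr : right_distributive poly_scale +%R.
Proof.
move=> p v w; rewrite -big_split; apply: eq_bigr => i _ /=.
rewrite -scalerDr; congr (_ *: _); elim: (i : nat) => //= k ->; exact: linearD.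
Qed.

Lemma poly_scaleC c v : poly_scale c%:P v = c *: (v : V).
Proof.
by rewrite (poly_scale_wide _ (size_polyC_leq1 c)) big_ord1 coefC.
Qed.

Lemma poly_scaleMX (p : {poly R}) v :
  poly_scale (p * 'X) v = poly_scale p (f v).
Proof.
have le : (size (p * 'X)%R <= (size p).+1)%N.
  by apply: leq_trans (size_polyMleq _ _) _; rewrite size_polyX addn2.
rewrite (poly_scale_wide _ le) big_ord_recl coefMX scale0r add0r.
by apply: eq_bigr => i _; rewrite coefMX /= -iterSr.
Qed.

Lemma poly_scaleMC (p : {poly R}) c v :
  poly_scale (p * c%:P) v = poly_scale p (c *: (v : V)).
Proof.
have le : (size (p * c%:P)%R <= size p)%N.
  by rewrite mulrC mul_polyC size_scale_leq.
rewrite (poly_scale_wide _ le); apply: eq_bigr => i _.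
rewrite coefMC -scalerA; congr (_ *: _).
by elim: (i : nat) => //= k <-; rewrite linearZ.
Qed.

Lemma poly_scaleA (p r : {poly R}) v :
  poly_scale p (poly_scale r v) = poly_scale (p * r) v.
Proof.
elim/poly_ind: r v => [|r c IHr] v.
  have z w : poly_scale 0 w = 0 by rewrite /poly_scale size_poly0 big_ord0.
  rewrite mulr0 z; apply: (addrI (poly_scale p 0)).
  by rewrite -poly_scaleDr !addr0.
rewrite poly_scaleDl poly_scaleDr mulrDr poly_scaleDl mulrA !poly_scaleMX IHr.
by rewrite poly_scaleC poly_scaleMC.
Qed.

Lemma poly_scale1 : left_id 1 poly_scale.
Proof. by move=> v; rewrite poly_scaleC scale1r. Qed.

HB.instance Definition _ := GRing.Zmodule_isLmodule.Build {poly R} W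
  poly_scaleA poly_scale1 poly_scaleDr poly_scaleDl.

Lemma scale_polyX (v : W) : 'X *: v = f v.
Proof. by rewrite -['X]mul1r [LHS]poly_scaleMX [LHS]poly_scale1. Qed.

Lemma scale_polyC c (v : W) : c%:P *: v = c *: (v : V).
Proof. exact: poly_scaleC. Qed.

(** This is what allows the construction to be iterated: a map commuting with
    the first variable can serve as the second one. *)
Lemma poly_linear (g : {linear V -> V}) : (forall v, g (f v) = f (g v)) ->
  linear (g : W -> W).
Proof.
move=> gf p v w.
have gD : {morph (g : W -> W) : a b / a + b} by exact: (linearD g).
rewrite gD; congr (_ + _).
elim/poly_ind: p v => [|p c IHp] v.
  by rewrite !scale0r; exact: (linear0 g).
rewrite !scalerDl gD; congr (_ + _).
  2: by rewrite !scale_polyC; exact: (linearZ_LR g).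
by rewrite -!scalerA !scale_polyX IHp; congr (_ *: _); exact: gf.
Qed.
End PolyModule.

(** * Multiplying by a in three places *)

(** A relation, rather than a map, because it is used in both directions: to
    read off a value of an element of M, and to build an element of M from an
    element of A. *)
Definition intertwines (F : fieldType) (A : algType F) (a : A)
    (R : comNzRingType) (c : F -> R) (M : lmodType R) (u v : R)
    (Rel : M -> A -> Prop) : Prop :=
  [/\ forall f g X Y, Rel f X -> Rel g Y -> Rel (f + g) (X + Y),
      forall k f X, Rel f X -> Rel (c k *: f) (k *: X),
      forall f X, Rel f X -> Rel (u *: f) (a * X)
    & forall f X, Rel f X -> Rel (v *: f) (X * a)].

(** Maps f from A to A stand for products with a variable first factor, such as
    X |-> X Y.  Multiplication by a to the left of X, to the right of X inside
    the argument, and to the right of the result are three commuting operators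
    on them, hence an action of polynomials in three variables. *)
Section ThreeSlots.
Variables (F : fieldType) (A : algType F) (a : A).

Definition slot_right (f : A -> A) : A -> A := fun X => f X * a.
Definition slot_middle (f : A -> A) : A -> A := fun X => f (X * a).
Definition slot_left (f : A -> A) : A -> A := fun X => a * f X.

Fact slot_right_linear : linear slot_right.
Proof.
by move=> k f g; apply/funext => X; rewrite /slot_right [LHS]mulrDl -scalerAl.
Qed.
HB.instance Definition _ := GRing.isLinear.Build F (A -> A) (A -> A) _
  slot_right slot_right_linear.

Fact slot_middle_linear : linear slot_middle.
Proof. by []. Qed.
HB.instance Definition _ := GRing.isLinear.Build F (A -> A) (A -> A) _
  slot_middle slot_middle_linear.

Fact slot_left_linear : linear slot_left.
Proof.
by move=> k f g; apply/funext => X; rewrite /slot_left [LHS]mulrDr -scalerAr.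
Qed.
HB.instance Definition _ := GRing.isLinear.Build F (A -> A) (A -> A) _
  slot_left slot_left_linear.

Let M1 : lmodType {poly F} := poly_module slot_right.

Definition slot_middle1 : M1 -> M1 := slot_middle.
Fact slot_middle1_linear : linear slot_middle1.
Proof. exact: (@poly_linear _ _ slot_right slot_middle). Qed.
HB.instance Definition _ := GRing.isLinear.Build {poly F} M1 M1 _
  slot_middle1 slot_middle1_linear.

Definition slot_left1 : M1 -> M1 := slot_left.
Fact slot_left1_linear : linear slot_left1.
Proof.
apply: (@poly_linear _ _ slot_right slot_left) => f.
by apply/funext => X; exact: mulrA.
Qed.
HB.instance Definition _ := GRing.isLinear.Build {poly F} M1 M1 _
  slot_left1 slot_left1_linear.

Let M2 : lmodType {poly {poly F}} := poly_module slot_middle1.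

Definition slot_left2 : M2 -> M2 := slot_left1.
Fact slot_left2_linear : linear slot_left2.
Proof. exact: (@poly_linear _ _ slot_middle1 slot_left1). Qed.
HB.instance Definition _ := GRing.isLinear.Build {poly {poly F}} M2 M2 _
  slot_left2 slot_left2_linear.

(* The variable adjoined last is the outermost one: the three variables are 'X
   on the left, 'X%:P in the middle and 'X%:P%:P on the right. *)
Definition slots : lmodType {poly {poly {poly F}}} := poly_module slot_left2.

Definition slotC : {rmorphism F -> {poly {poly {poly F}}}} :=
  (polyC \o polyC) \o polyC.

Definition slot_eval (f : slots) (X : A) : A := (f : A -> A) X.

Implicit Types (X Y Z : A) (f g : slots).

Local Notation "f @ X" := (slot_eval f X) (at level 10).
Local Notation x := ('X : {poly {poly {poly F}}}).
Local Notation y := ('X%:P : {poly {poly {poly F}}}).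
Local Notation z := ('X%:P%:P : {poly {poly {poly F}}}).

Lemma slot_evalD (f g : slots) X : (f + g) @ X = f @ X + g @ X.
Proof. by []. Qed.

Lemma slot_evalC k f X : (slotC k *: f) @ X = k *: (f @ X).
Proof. by rewrite /slotC /= [slotC k *: f]scale_polyC !scale_polyC. Qed.

Lemma slot_evalx f X : (x *: f) @ X = a * f @ X.
Proof. by rewrite [x *: f]scale_polyX. Qed.

Lemma slot_evaly f X : (y *: f) @ X = f @ (X * a).
Proof. by rewrite [y *: f]scale_polyC [_ *: _]scale_polyX. Qed.

Lemma slot_evalz f X : (z *: f) @ X = f @ X * a.
Proof.
by rewrite [z *: f]scale_polyC [_ *: _]scale_polyC [_ *: _]scale_polyX.
Qed.

Definition rel_outer X (f : slots) Y := slot_eval f X = Y.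

Lemma outer_intertwines X : intertwines a slotC x z (rel_outer X).
Proof.
rewrite /rel_outer; split=> [g h Y Z <- <-|k g Y <-|g Y <-|g Y <-] //.
- exact: slot_evalC.
- exact: slot_evalx.
- exact: slot_evalz.
Qed.

Definition slot_mulr Y : slots := fun X => X * Y.

Definition rel_right (f : slots) Y := f = slot_mulr Y.

Lemma right_intertwines : intertwines a slotC y z rel_right.
Proof.
rewrite /rel_right; split=> [g h Y Z -> ->|k g Y ->|g Y ->|g Y ->];
  apply/funext => X.
- by rewrite /slot_mulr mulrDr.
- by rewrite [LHS]slot_evalC /slot_mulr -scalerAr.
- by rewrite [LHS]slot_evaly /slot_eval /slot_mulr mulrA.
- by rewrite [LHS]slot_evalz /slot_eval /slot_mulr mulrA.
Qed.

(** The middle operator moves the argument, so the value at X alone does not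
    determine the action; the values at all X a^k do. *)
Definition rel_inner Y X (f : slots) Z :=
  forall k : nat, f @ (X * a ^+ k) = Z * a ^+ k * Y.

Lemma inner_intertwines Y X : intertwines a slotC x y (rel_inner Y X).
Proof.
rewrite /rel_inner; split=> [g h Z Z' gZ hZ' k|k g Z gZ i|g Z gZ k|g Z gZ k].
- by rewrite slot_evalD gZ hZ' !mulrDl.
- by rewrite slot_evalC gZ -!scalerAl.
- by rewrite slot_evalx gZ !mulrA.
- by rewrite slot_evaly -[X * _ * a]mulrA -exprSr gZ exprS !mulrA.
Qed.

Definition slot_null X (f : slots) := forall k : nat, f @ (X * a ^+ k) = 0.

(** All three operators preserve the vanishing at every X a^k. *)
Lemma slot_null_scale X (p : {poly {poly {poly F}}}) f :
  slot_null X f -> slot_null X (p *: f).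
Proof.
have nullD g h : slot_null X g -> slot_null X h -> slot_null X (g + h).
  by move=> g0 h0 k; rewrite slot_evalD g0 h0 addr0.
have null0 g : slot_null X g -> slot_null X (0 *: g).
  by move=> _ k; rewrite scale0r.
elim/poly_ind: p f => [|p d IHp] f f0; first exact: null0.
rewrite scalerDl; apply: (nullD).
  by rewrite -scalerA; apply: IHp => k; rewrite slot_evalx f0 mulr0.
elim/poly_ind: d f f0 => [|d e IHd] f f0; first by rewrite polyC0; exact: null0.
rewrite polyCD polyCM scalerDl; apply: (nullD).
  by rewrite -scalerA; apply: IHd => k; rewrite slot_evaly -mulrA -exprSr f0.
elim/poly_ind: e f f0 => [|e k IHe] f f0.
  by rewrite !polyC0; exact: null0.
rewrite !polyCD !polyCM scalerDl; apply: (nullD).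
  by rewrite -scalerA; apply: IHe => k'; rewrite slot_evalz f0 mul0r.
move=> i; transitivity (k *: slot_eval f (X * a ^+ i)); first exact: slot_evalC.
by rewrite f0 scaler0.
Qed.

(** On constant maps the left and right operators are multiplication by a in A,
    so that algebraic properties of polynomials in them, such as linearity,
    follow from the module axioms. *)
Definition slot_const Y : slots := fun=> Y.

Section Constants.
Variable p : {poly {poly {poly F}}}.

Lemma slot_constD X Y :
  slot_eval (p *: slot_const (X + Y)) 0 =
  slot_eval (p *: slot_const X) 0 + slot_eval (p *: slot_const Y) 0.
Proof.
have -> : slot_const (X + Y) = slot_const X + slot_const Y by [].
by rewrite scalerDr.
Qed.

Lemma slot_constZ k X :
  slot_eval (p *: slot_const (k *: X)) 0 = k *: slot_eval (p *: slot_const X) 0.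
Proof.
rewrite -[RHS]slot_evalC scalerA mulrC -scalerA; congr (slot_eval (_ *: _) _).
by apply/funext => Y; rewrite [RHS]slot_evalC.
Qed.

Lemma slot_const_mull X :
  slot_eval (p *: slot_const (a * X)) 0 = a * slot_eval (p *: slot_const X) 0.
Proof.
rewrite -[RHS]slot_evalx scalerA mulrC -scalerA; congr (slot_eval (_ *: _) _).
by apply/funext => Y; rewrite [RHS]slot_evalx.
Qed.

Lemma slot_const_mulr X :
  slot_eval (p *: slot_const (X * a)) 0 = slot_eval (p *: slot_const X) 0 * a.
Proof.
rewrite -[RHS]slot_evalz scalerA mulrC -scalerA; congr (slot_eval (_ *: _) _).
by apply/funext => Y; rewrite [RHS]slot_evalz.
Qed.

Lemma slot_const_qcomm r t X :
  slot_eval (p *: slot_const (r *: (a * X) - t *: (X * a))) 0 =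
  r *: (a * slot_eval (p *: slot_const X) 0)
  - t *: (slot_eval (p *: slot_const X) 0 * a).
Proof.
rewrite -[- (t *: (X * a))]scaleNr slot_constD !slot_constZ.
by rewrite slot_const_mull slot_const_mulr scaleNr.
Qed.
End Constants.
End ThreeSlots.

(** * Polynomials in the two multiplications by A *)

Section QDiff.
Variables (F : fieldType) (q : F).

Lemma qdiffV k : qdiff q^-1 k = - qdiff q k.
Proof. by rewrite /qdiff -!exprVn invrK opprB. Qed.

Lemma qdiff_neq0 k : q != 0 -> not_root_of_unity q -> (0 < k)%N ->
  qdiff q k != 0.
Proof.
move=> q0 q_nroot k0; have qk0 : q ^+ k != 0 by exact: expf_neq0.
have := q_nroot (k + k)%N; rewrite addn_gt0 k0 => /(_ isT).
by apply: contra; rewrite subr_eq0 exprD => /eqP {1}->; rewrite mulVf.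
Qed.
End QDiff.

Section BandPolynomialsV.
Variables (F : fieldType) (q : F) (R : comNzRingType) (c : {rmorphism F -> R}).

Lemma band_polyV n x y : band_poly q^-1 c n x y = - band_poly q c n x y.
Proof.
elim: n => [|n IHn] /=; first by rewrite qdiffV invrN rmorphN mulNr.
rewrite IHn mulNr /band_ratio /strip !qdiffV mulrNN sqrrN.
by rewrite -!exprVn invrK [q^-1 ^+ _ + _]addrC.
Qed.
End BandPolynomialsV.

(** Two opposite q-commutators compose to a quadratic polynomial in left and
    right multiplication; the scalars cancel on the two pure squares. *)
Lemma qcomm_qcommV (F : fieldType) (C : algType F) (s t : F) (a X : C) :
  s * t = 1 ->
  s *: (a * (t *: (a * X) - s *: (X * a)))
    - t *: ((t *: (a * X) - s *: (X * a)) * a) =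
  a * (a * X) + X * a * a - (s * s + t * t) *: (a * X * a).
Proof.
move=> st1; have ts1 : t * s = 1 by rewrite mulrC.
rewrite mulrBr mulrBl !scalerBr -!scalerAr -!scalerAl !scalerA st1 ts1 !scale1r.
rewrite scalerDl mulrA opprB opprD [a * (X * a)]mulrA.
exact: addrACA.
Qed.

Lemma scale1B (F : fieldType) (V : lmodType F) (x y : V) :
  1 *: x - 1 *: y = x - y.
Proof. by rewrite !scale1r. Qed.

(* Lets the product of maps in adA_prod be unfolded at its last factor. *)
HB.instance Definition _ (T : Type) :=
  Monoid.isLaw.Build (T -> T) idfun (@comp T T T)
    (fun f g h => erefl) (fun f => erefl) (fun f => erefl).

Section AdA.
Variables (F : fieldType) (q : F).
Hypothesis q0 : q != 0.
Local Notation O := (qOnsager q).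
Local Notation A := (genA : O).
Implicit Types (X Y : O).

Lemma adA_0 X : adA q 0 X = A * X - X * A.
Proof. exact: scale1B. Qed.

Lemma adA_prod1 X : adA_prod q 1 X = (qdiff q 1)^-1 *: adA q 0 X.
Proof. by rewrite /adA_prod big_geq. Qed.

Lemma adA_prodS n X :
  adA_prod q n.+2 X = adA_prod q n.+1 (adA_factor q n.+1 X).
Proof. by rewrite /adA_prod big_nat_recr. Qed.

Lemma adA_adAN n X : adA q n%:Z (adA q (- n%:Z) X) =
  A * (A * X) + X * A * A - (q ^+ (2 * n) + q ^- (2 * n)) *: (A * X * A).
Proof.
rewrite /adA opprK -exprnN -exprnP mul2n -addnn exprD invfM.
by apply: qcomm_qcommV; rewrite mulfV ?expf_neq0.
Qed.

(** The two series, for the automorphism and for its inverse, are exchanged by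
    replacing q with its inverse. *)
Variant direction := forward | backward.

Definition qdir s := if s is forward then q else q^-1.

Definition lusztig_term s n : O -> O :=
  adA_prod q n \o
    ((qdiff q (2 * n))^-1 \*: adA q (if s is forward then n%:Z else - n%:Z)).

Definition lusztig_sum s n X : O := X + \sum_(1 <= k < n.+1) lusztig_term s k X.

(** The maps of the theorem are the values of the polynomials above at left and
    right multiplication by A, through any relation that turns u and v into
    these multiplications. *)
Section Transfer.
Variables (R : comNzRingType) (c : {rmorphism F -> R}) (M : lmodType R).
Variables (u v : R) (Rel : M -> O -> Prop).
Hypothesis RelP : intertwines A c u v Rel.
Implicit Types (f g : M).

Let RelD f g X Y : Rel f X -> Rel g Y -> Rel (f + g) (X + Y).
Proof. by case: RelP => + _ _ _; apply. Qed.

Let RelZ k f X : Rel f X -> Rel (c k *: f) (k *: X).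
Proof. by case: RelP => _ + _ _; apply. Qed.

Let Relu f X : Rel f X -> Rel (u *: f) (A * X).
Proof. by case: RelP => _ _ + _; apply. Qed.

Let Relv f X : Rel f X -> Rel (v *: f) (X * A).
Proof. by case: RelP => _ _ _; apply. Qed.

Let RelB f g X Y : Rel f X -> Rel g Y -> Rel (f - g) (X - Y).
Proof.
move=> fX /(RelZ (-1)) gY; rewrite -[- g]scaleN1r -[- Y]scaleN1r.
by apply: RelD => //; rewrite rmorphN1 in gY.
Qed.

Lemma rel_band_ratio n f X :
  Rel f X -> Rel (band_ratio q c n u v *: f) (adA_factor q n X).
Proof.
move=> fX; rewrite /band_ratio /adA_factor /= -scalerA; apply: (RelZ).
rewrite adA_adAN [_ *: X + _]addrC /strip [(_ + _) *: f]scalerDl.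
apply: RelD; last exact: RelZ.
rewrite [(_ - _) *: f]scalerBl; apply: RelB.
  rewrite scalerDl !expr2 -!scalerA.
  by apply: RelD; [apply: (Relu); apply: (Relu) | apply: (Relv); apply: (Relv)].
rewrite -!scalerA -mulrA; apply: (RelZ).
by apply: (Relu); apply: (Relv).
Qed.

Lemma rel_band_poly n f X :
  Rel f X -> Rel (band_poly q c n u v *: f) (adA_prod q n.+1 X).
Proof.
elim: n f X => [|n IHn] f X fX.
  rewrite adA_prod1 /= -scalerA; apply: (RelZ); rewrite scalerBl.
  by rewrite adA_0; apply: RelB; [apply: Relu | apply: Relv].
by rewrite adA_prodS /= -scalerA; apply/IHn/rel_band_ratio.
Qed.

Lemma rel_lusztig_term s n f X : Rel f X ->
  Rel ((band_poly (qdir s) c n u v * qcomm (qdir s) c n.+1 u v) *: f)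
      (lusztig_term s n.+1 X).
Proof.
move=> fX.
suff H k r t : Rel ((band_poly q c n u v * (c k * (c r * u - c t * v))) *: f)
    (adA_prod q n.+1 (k *: (r *: (A * X) - t *: (X * A)))).
  case: s; rewrite /lusztig_term /qcomm /adA /=.
    by rewrite -exprnP -exprnN; exact: H.
  (* For 1/q both band_poly and the denominator of qcomm change sign. *)
  rewrite band_polyV mulNr -mulrN -mulNr -rmorphN qdiffV invrN opprK.
  by rewrite opprK -exprnP -exprnN -!exprVn invrK; exact: H.
rewrite -scalerA; apply: rel_band_poly; rewrite -scalerA; apply: (RelZ).
rewrite scalerBl -!scalerA.
by apply: RelB; apply: (RelZ); [apply: Relu | apply: Relv].
Qed.

Lemma rel_lusztig_poly s n f X :
  Rel f X -> Rel (lusztig_poly (qdir s) c n u v *: f) (lusztig_sum s n X).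
Proof.
move=> fX; elim: n => [|n IHn].
  by rewrite /lusztig_sum big_geq // addr0 scale1r.
rewrite /lusztig_sum big_nat_recr //= addrA scalerDl.
by apply: RelD => //; exact: rel_lusztig_term.
Qed.
End Transfer.
End AdA.

(** * The generators *)

Lemma freeAlg2_ind (F : fieldType) (P : freeAlg2 F -> Prop) :
  P 1 -> (forall g, P g -> P (g * freeA F)) ->
  (forall g, P g -> P (g * freeB F)) ->
  (forall k g, P g -> P (k *: g)) ->
  (forall g h, P g -> P h -> P (g + h)) ->
  forall g, P g.
Proof.
move=> P1 PA PB PZ PD g.
have ZU (k : F) (m : {fmonom bool}) :
    << k *g m >> = k *: << m >> :> freeAlg2 F.
  by apply/malgP => m'; rewrite mcoeffZ !mcoeffU mulr_natr.
have PU m : P << m >>.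
  case: m => s; elim/last_ind: s => [|s i IHs].
    suff -> : FMonom [::] = @one {fmonom bool} by [].
    by apply/eqP; rewrite fmP fm1.
  have -> : << FMonom (rcons s i) >> =
      << FMonom s >> * << fmu i >> :> freeAlg2 F.
    rewrite malgM_def fgmulUU mulr1; congr << _ *g _ >>.
    by apply/eqP; rewrite fmP fmM fmU cats1.
  by case: i; [exact: PA | exact: PB].
rewrite [g]monalgE; apply: big_ind => [||m _].
- by rewrite -(scale0r 1); exact: PZ.
- exact: PD.
- by rewrite ZU; exact: PZ.
Qed.

Lemma qOnsager_ind (F : fieldType) (q : F) (P : qOnsager q -> Prop) :
  P 1 -> (forall X, P X -> P (X * genA)) -> (forall X, P X -> P (X * genB)) ->
  (forall k X, P X -> P (k *: X)) ->
  (forall X Y, P X -> P Y -> P (X + Y)) ->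
  forall X, P X.
Proof.
move=> P1 PA PB PZ PD X; rewrite -[X]qOnsager_reprK.
elim/freeAlg2_ind: (qOnsager_repr X) => [|g|g|k g|g h] //.
- by rewrite rmorphM; exact: PA.
- by rewrite rmorphM; exact: PB.
- by rewrite qOnsager_piZ; exact: PZ.
- by rewrite linearD; exact: PD.
Qed.

Section CubicVanishing.
Variables (F : fieldType) (q : F) (C : algType F).
Hypotheses (q0 : q != 0) (d1 : qdiff q 1 != 0).

Lemma qint3 : qint q 3 = q ^+ 2 + q ^- 2 + 1.
Proof.
rewrite /qint; apply: (mulIf d1); rewrite divfK // /qdiff.
by field.
Qed.

(** The cubic map of the second product is the q-Dolan/Grady expression; this
    is where the defining relation of the algebra enters. *)
Lemma comm_strip (k l : F) (a b : C) :
  let W := qdiff q 2 ^+ 2 *: b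
           + (a * (a * b) + b * a * a - (q ^+ 2 + q ^- 2) *: (a * b * a)) in
  k *: (a * (l *: W) - (l *: W) * a) = (k * l) *: qDolanGrady q a b.
Proof.
move=> W; rewrite -scalerAr -scalerAl -scalerBr scalerA; congr (_ *: _).
rewrite {}/W /qDolanGrady qint3.
move: (q ^+ 2 + q ^- 2) (qdiff q 2 ^+ 2) => g e.
rewrite !mulrDr !mulrDl mulrN mulNr -!scalerAr -!scalerAl.
rewrite !exprS expr0 !mulr1 !mulrA !scalerDl !scale1r scalerBr !opprD !opprK.
exact: (AC ((1*3)*(1*3)) ((2*(4*6)*(8*3)*7*(5*1)))).
Qed.

Lemma qcomm_comm (k l r t : F) (a b : C) :
  k *: (a * (l *: (r *: (a * b) - t *: (b * a)))
        - l *: (r *: (a * b) - t *: (b * a)) * a)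
  = (k * l) *: (r *: (a ^+ 2 * b) - (r + t) *: (a * b * a) + t *: (b * a ^+ 2)).
Proof.
rewrite -!scalerAr -scalerAl -scalerBr scalerA; congr (_ *: _).
rewrite mulrBr mulrBl -!scalerAr -!scalerAl scalerDl !expr2 !mulrA.
by rewrite !opprD !opprK; exact: (AC (2*2) (1*(3*2)*4)).
Qed.
End CubicVanishing.

Section Generators.
Variables (F : fieldType) (q : F).
Hypothesis q0 : q != 0.
Hypothesis q_nroot : not_root_of_unity q.
Local Notation O := (qOnsager q).
Local Notation A := (genA : O).
Local Notation B := (genB : O).

Lemma adA_factorE n X : adA_factor q n X =
  (qdiff q (2 * n) * qdiff q (2 * n + 1))^-1 *:
    (qdiff q (2 * n) ^+ 2 *: X + (A * (A * X) + X * A * A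
      - (q ^+ (2 * n) + q ^- (2 * n)) *: (A * X * A))).
Proof. by rewrite -adA_adAN. Qed.

Lemma adA_prod2_genB : adA_prod q 2 B = 0.
Proof.
have d1 : qdiff q 1 != 0 by exact: qdiff_neq0.
rewrite adA_prodS adA_prod1 adA_0 adA_factorE.
by rewrite (comm_strip q0 d1) qOnsager_rel1 scaler0.
Qed.

Definition opposite s := if s is forward then backward else forward.

Lemma lusztig_term1 s X : lusztig_term s 1 X =
  (qdiff q 1)^-1 *: adA q 0
    ((qdiff q 2)^-1 *: (qdir q s *: (A * X) - qdir q (opposite s) *: (X * A))).
Proof. by case: s; exact: adA_prod1. Qed.

Lemma lusztig_sum1_genB s :
  lusztig_sum s 1 B = B + (qdiff q 1 * qdiff q 2)^-1 *:
  (qdir q s *: (A ^+ 2 * B) - (q + q^-1) *: (A * B * A)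
   + qdir q (opposite s) *: (B * A ^+ 2)).
Proof.
have -> : q + q^-1 = qdir q s + qdir q (opposite s).
  by case: s; rewrite //= addrC.
rewrite /lusztig_sum big_nat1 lusztig_term1 adA_0 qcomm_comm.
by rewrite [in RHS]invfM.
Qed.
End Generators.

(** * Multiplicativity of the series *)

Section Slots.
Variables (F : fieldType) (q : F).
Hypothesis q0 : q != 0.
Local Notation O := (qOnsager q).
Local Notation A := (genA : O).
Local Notation M := (slots A).
Local Notation R := {poly {poly {poly F}}}.
Local Notation c := (slotC F).
Local Notation x := ('X : R).
Local Notation y := ('X%:P : R).
Local Notation z := ('X%:P%:P : R).
Implicit Types (X Y Z : O) (f : M) (n : nat).

Lemma band_poly_outer n f X :
  slot_eval (band_poly q c n x z *: f) X = adA_prod q n.+1 (slot_eval f X).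
Proof. exact: (rel_band_poly q0 (outer_intertwines A X)). Qed.

Lemma lusztig_poly_outer s n f X :
  slot_eval (lusztig_poly (qdir q s) c n x z *: f) X
  = lusztig_sum s n (slot_eval f X).
Proof. exact: (rel_lusztig_poly q0 (outer_intertwines A X)). Qed.

Lemma band_poly_right n Y :
  band_poly q c n y z *: slot_mulr A Y = slot_mulr A (adA_prod q n.+1 Y).
Proof. exact: (rel_band_poly q0 (right_intertwines A)). Qed.

Lemma lusztig_poly_right s n Y :
  lusztig_poly (qdir q s) c n y z *: slot_mulr A Y
  = slot_mulr A (lusztig_sum s n Y).
Proof. exact: (rel_lusztig_poly q0 (right_intertwines A)). Qed.

Lemma band_poly_inner n X Y k :
  slot_eval (band_poly q c n x y *: slot_mulr A Y) (X * A ^+ k)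
  = adA_prod q n.+1 X * A ^+ k * Y.
Proof. exact: (rel_band_poly q0 (inner_intertwines A Y X)). Qed.

Lemma lusztig_poly_inner s n X Y :
  slot_eval (lusztig_poly (qdir q s) c n x y *: slot_mulr A Y) X
  = lusztig_sum s n X * Y.
Proof.
have := rel_lusztig_poly q0 (inner_intertwines A Y X) s n (f := slot_mulr A Y).
by move=> /(_ X (fun=> erefl) 0); rewrite !expr0 !mulr1.
Qed.

End Slots.

Lemma qdir_neq0 (F : fieldType) (q : F) s : q != 0 -> qdir q s != 0.
Proof. by case: s => //=; rewrite invr_eq0. Qed.

Section Main.
Variables (F : fieldType) (q : F).
Hypothesis q0 : q != 0.
Hypothesis q_nroot : not_root_of_unity q.
Local Notation O := (qOnsager q).
Local Notation A := (genA : O).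
Local Notation B := (genB : O).
Local Notation c := (slotC F).
Local Notation R := {poly {poly {poly F}}}.
Local Notation x := ('X : R).
Local Notation y := ('X%:P : R).
Local Notation z := ('X%:P%:P : R).
Implicit Types (X Y Z : O) (n : nat).

Lemma adA_prod_const n Y :
  adA_prod q n.+1 Y = slot_eval (band_poly q c n x z *: slot_const A Y) 0.
Proof. by rewrite band_poly_outer. Qed.

Lemma lusztig_sum_const s n Y :
  lusztig_sum s n Y
  = slot_eval (lusztig_poly (qdir q s) c n x z *: slot_const A Y) 0.
Proof. by rewrite lusztig_poly_outer. Qed.

Lemma adA_prod_adA n r X :
  adA_prod q n.+1 (adA q r X) = adA q r (adA_prod q n.+1 X).
Proof. by rewrite !adA_prod_const; exact: slot_const_qcomm. Qed.

Lemma adA_prodD n X Y :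
  adA_prod q n.+1 (X + Y) = adA_prod q n.+1 X + adA_prod q n.+1 Y.
Proof. by rewrite !adA_prod_const; exact: slot_constD. Qed.

Lemma adA_prodZ n k X : adA_prod q n.+1 (k *: X) = k *: adA_prod q n.+1 X.
Proof. by rewrite !adA_prod_const; exact: slot_constZ. Qed.

Lemma adA_prod_mulA n X : adA_prod q n.+1 (X * A) = adA_prod q n.+1 X * A.
Proof. by rewrite !adA_prod_const; exact: slot_const_mulr. Qed.

Lemma lusztig_sumD s n X Y :
  lusztig_sum s n (X + Y) = lusztig_sum s n X + lusztig_sum s n Y.
Proof. by rewrite !lusztig_sum_const; exact: slot_constD. Qed.

Lemma lusztig_sumZ s n k X : lusztig_sum s n (k *: X) = k *: lusztig_sum s n X.
Proof. by rewrite !lusztig_sum_const; exact: slot_constZ. Qed.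

Lemma lusztig_sum_mulA s n X : lusztig_sum s n (X * A) = lusztig_sum s n X * A.
Proof. by rewrite !lusztig_sum_const; exact: slot_const_mulr. Qed.

Lemma adA0 r : adA q r 0 = 0.
Proof. by rewrite /adA mulr0 mul0r !scaler0 subr0. Qed.

Lemma lusztig_term_eq0 s n X :
  adA_prod q n.+1 X = 0 -> lusztig_term s n.+1 X = 0.
Proof.
move=> X0; rewrite /lusztig_term /= adA_prodZ.
by rewrite adA_prod_adA X0 adA0 scaler0.
Qed.

Lemma adA_prod_eq0S n X : adA_prod q n.+1 X = 0 -> adA_prod q n.+2 X = 0.
Proof.
move=> X0; rewrite adA_prodS /adA_factor /= adA_prodZ adA_prodD adA_prodZ.
rewrite !adA_prod_adA X0.
by rewrite !adA0 scaler0 addr0 scaler0.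
Qed.

Lemma qdiffN0 k : (0 < k)%N -> qdiff q k != 0.
Proof. exact: qdiff_neq0. Qed.

Lemma qdiff_qdir_neq0 s k : (0 < k)%N -> qdiff (qdir q s) k != 0.
Proof. by case: s => /= /qdiffN0; rewrite ?qdiffV ?oppr_eq0. Qed.

Lemma band_poly_dir s n (u v : R) : exists e : R,
  band_poly (qdir q s) c n u v = e * band_poly q c n u v.
Proof.
case: s => /=; first by exists 1; rewrite mul1r.
by exists (-1); rewrite band_polyV mulN1r.
Qed.

Lemma slot_right_eq0 n Y : adA_prod q n.+1 Y = 0 ->
  band_poly q c n y z *: slot_mulr A Y = 0.
Proof.
by move=> Y0; rewrite band_poly_right // Y0; apply/funext => X; exact: mulr0.
Qed.

Lemma slot_inner_eq0 n X Y p : adA_prod q n.+1 X = 0 ->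
  slot_eval ((p * band_poly q c n x y) *: slot_mulr A Y) X = 0.
Proof.
move=> X0; rewrite -scalerA.
have := @slot_null_scale _ _ A X p (band_poly q c n x y *: slot_mulr A Y).
move=> /(_ _ 0); rewrite expr0 mulr1; apply=> k.
by rewrite band_poly_inner // X0 !mul0r.
Qed.

(** Multiplying by B on the right increases the width by at most 1. *)
Lemma adA_prod_mulB n X :
  adA_prod q n.+1 X = 0 -> adA_prod q n.+2 (X * B) = 0.
Proof.
move=> X0; have [v vE] := band_poly_step c qdiffN0 q0 n x y z.
have <- := band_poly_outer q0 n.+1 (slot_mulr A B) X.
have b1 := slot_right_eq0 (adA_prod2_genB q0 q_nroot).
have bn := @slot_inner_eq0 n X B (band_step q c n.+1 x y z) X0.
by rewrite vE mulrC scalerDl slot_evalD bn -scalerA b1 scaler0 addr0.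
Qed.

(** The partial sums are multiplicative at X B: of the three terms of
    lusztig_poly_step, the second vanishes because of the width of X and the
    third because of the width of B. *)
Lemma lusztig_sum_mulB s n X : adA_prod q n.+1 X = 0 ->
  lusztig_sum s n.+1 (X * B) = lusztig_sum s n X * lusztig_sum s 1 B.
Proof.
move=> X0.
have [w wE] :=
  lusztig_poly_step c (@qdiff_qdir_neq0 s) (qdir_neq0 s q0) n x y z.
have <- := lusztig_poly_outer q0 s n.+1 (slot_mulr A B) X.
have [e1 E1] := band_poly_dir s n x y; have [e2 E2] := band_poly_dir s 1 y z.
have b1 := slot_right_eq0 (adA_prod2_genB q0 q_nroot).
have bn := @slot_inner_eq0 n X B (e1 * lusztig_step (qdir q s) c n x y z) X0.
have l1 := lusztig_poly_right q0 s 1 B.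
rewrite wE E1 E2 (mulrAC e1) (mulrA w) 2!scalerDl 2!slot_evalD bn.
rewrite -[(_ * band_poly q c 1 y z) *: _]scalerA b1 scaler0.
by rewrite -scalerA l1 lusztig_poly_inner // !addr0.
Qed.

(** The width bound belongs to the induction hypothesis: it makes the partial
    sums at X constant from index n on, and lusztig_sum_mulB needs it. *)
Definition lusztig_at s (L : O -> O) n X :=
  adA_prod q n.+1 X = 0 /\ L X = lusztig_sum s n X.

Lemma lusztig_atW s L m n X :
  (m <= n)%N -> lusztig_at s L m X -> lusztig_at s L n X.
Proof.
move=> /subnK <-; elim: (n - m)%N => [|k IHk] // /IHk [X0 LX].
split; first exact: adA_prod_eq0S.
rewrite LX /lusztig_sum addSn [in RHS]big_nat_recr //=.
by rewrite lusztig_term_eq0 ?addr0.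
Qed.

(** A morphism is determined by its values at the generators, so the same
    argument serves the Lusztig automorphism and its inverse. *)
Lemma lusztig_sum_reaches s (L : O -> O) :
  L 1 = 1 -> {morph L : X Y / X + Y} -> {morph L : X Y / X * Y} ->
  (forall k, {morph L : X / k *: X}) -> L A = A -> L B = lusztig_sum s 1 B ->
  forall X, exists n, lusztig_at s L n X.
Proof.
move=> L1 LD LM LZ LA LB; elim/qOnsager_ind => [|X|X|k X|X Y].
- exists 0%N; split.
    by rewrite adA_prod1 adA_0 mulr1 mul1r subrr scaler0.
  by rewrite L1 /lusztig_sum big_geq // addr0.
- move=> [n [X0 LX]]; exists n; split; first by rewrite adA_prod_mulA X0 mul0r.
  by rewrite LM LX LA lusztig_sum_mulA.
- move=> [n [X0 LX]]; exists n.+1; split; first exact: adA_prod_mulB.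
  by rewrite LM LX LB lusztig_sum_mulB.
- move=> [n [X0 LX]]; exists n; split; first by rewrite adA_prodZ X0 scaler0.
  by rewrite LZ LX lusztig_sumZ.
- move=> [m Xm] [n Yn]; exists (maxn m n).
  have [X0 LX] := lusztig_atW (leq_maxl m n) Xm.
  have [Y0 LY] := lusztig_atW (leq_maxr m n) Yn.
  split; first by rewrite adA_prodD X0 Y0 addr0.
  by rewrite LD LX LY lusztig_sumD.
Qed.

End Main.

Theorem theorem2p1 (F : fieldType) (q : F) (q_neq0 : q != 0)
    (q_nroot : not_root_of_unity q)
    (L : {lrmorphism qOnsager q -> qOnsager q})
    (Linv : qOnsager q -> qOnsager q)
    (L_Lusztig : Lusztig_automorphism L Linv) :
  [/\ exists S : qOnsager q -> qOnsager q,
        is_formal_sum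
          (fun n => adA_prod q n \o ((qdiff q (2 * n))^-1 \*: adA q n%:Z)) S
        /\ L =1 idfun \+ S,
      exists S : qOnsager q -> qOnsager q,
        is_formal_sum
          (fun n => adA_prod q n \o ((qdiff q (2 * n))^-1 \*: adA q (- n%:Z))) S
        /\ Linv =1 idfun \+ S
    & forall X : qOnsager q, exists N : nat,
        forall n : nat, (1 <= n)%N -> (N < n)%N -> adA_prod q n X = 0].
Proof.
case: L_Lusztig => LK VK LA LB VA VB.
have Lsum : forall X, exists n, lusztig_at forward L n X.
  apply: (lusztig_sum_reaches q_neq0 q_nroot).
  - exact: rmorph1.
  - exact: rmorphD.
  - exact: rmorphM.
  - by move=> k X; exact: linearZ.
  - exact: LA.
  - by rewrite (lusztig_sum1_genB q forward); exact: LB.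
(* The inverse map is a morphism because L is injective. *)
have Linj : injective L := can_inj LK.
have Vsum : forall X, exists n, lusztig_at backward Linv n X.
  apply: (lusztig_sum_reaches q_neq0 q_nroot).
  - by apply: Linj; rewrite VK rmorph1.
  - move=> X Y; apply: Linj; rewrite VK (rmorphD L).
    exact: congr2 (esym (VK X)) (esym (VK Y)).
  - move=> X Y; apply: Linj; rewrite VK (rmorphM L).
    exact: congr2 (esym (VK X)) (esym (VK Y)).
  - move=> k X; apply: Linj; rewrite VK [RHS]linearZ.
    exact: congr1 (esym (VK X)).
  - exact: VA.
  - by rewrite (lusztig_sum1_genB q backward); exact: VB.
have formal s (f : qOnsager q -> qOnsager q) :
    (forall X, exists n, lusztig_at s f n X) ->
    exists S, is_formal_sum (lusztig_term s) S /\ f =1 idfun \+ S.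
  move=> fsum; exists (fun X => f X - X).
  split=> X; last by rewrite /= addrC subrK.
  have [n fX] := fsum X; exists n; split.
    case=> [n0|k nk]; first by case: (notF n0).
    have [X0 _] := lusztig_atW q_neq0 (ltnSE nk) fX.
    exact: lusztig_term_eq0.
  by case: fX => _ ->; rewrite /lusztig_sum addrC addKr.
split; [exact: (formal forward) | exact: (formal backward) |] => X.
have [n Xn] := Lsum X; exists n; case=> [n0|k _ nk]; first by case: (notF n0).
by have [X0 _] := lusztig_atW q_neq0 (ltnSE nk) Xn.
Qed.
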